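(* Let $D=(V(D),A(D))$ be a finite directed graph without self-loops that is source-free, i.e., every vertex $v\in V(D)$ has at least one ingoing arc $u\to v$ with $u\in V(D)$. If $D$ has a kernel, then $D$ has a quasi-kernel $Q$ with $|Q|\leq |V(D)|/2$.
   Context: For a directed graph $D$, write $u\to v$ for $(u,v)\in A(D)$. A set $I\subseteq V(D)$ is independent if there are no $u,v\in I$ with $u\to v$. A kernel is an independent set $K\subseteq V(D)$ such that every vertex $v\in V(D)\setminus K$ has an arc $u\to v$ for some $u\in K$. A quasi-kernel is an independent set $Q\subseteq V(D)$ such that every vertex of $V(D)$ either lies in $Q$, or has an in-neighbor in $Q$, or is reachable from some vertex of $Q$ by a directed path of length two (i.e., every vertex is reachable from $Q$ in at most two steps). *)

(* Defs.v *)
From mathcomp Require Import all_boot.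

Set Implicit Arguments.
Unset Strict Implicit.
Unset Printing Implicit Defensive.

(* A finite digraph is a relation [arc] on a finType of vertices;
   [arc u v] is the arc u -> v.  Opposite arcs are allowed. *)
Section Digraph.
Variables (V : finType) (arc : rel V).

Definition source_free : Prop := forall v : V, exists u : V, arc u v.

Definition independent (I : {set V}) : Prop :=
  forall u v : V, u \in I -> v \in I -> ~~ arc u v.

Definition is_kernel (K : {set V}) : Prop :=
  independent K /\
  forall v : V, v \notin K -> exists2 u : V, u \in K & arc u v.

(* The two-step walk u -> w -> v need not be required to have distinct
   vertices: without loops only u = v can occur, and then v is in Q. *)
Definition is_quasi_kernel (Q : {set V}) : Prop :=
  independent Q /\
  forall v : V,
    [\/ v \in Q,
        exists2 u : V, u \in Q & arc u v
      | exists2 u : V, u \in Q & exists w : V, arc u w /\ arc w v].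

End Digraph.

(* Main.v *)
Require Import Defs.
From mathcomp Require Import all_boot.

(** For each vertex outside a kernel [K] choose an in-neighbour in [K], and let
    [Q] be the set of chosen vertices.  Then [#|Q|] is at most both [#|K|] and
    [#|~: K|].  [Q] reaches [~: K] in one step, and hence [K] in two, since the
    in-neighbours of a vertex of the independent set [K] lie outside [K]. *)

Theorem theorem4 (V : finType) (arc : rel V)
    (loopless : irreflexive arc)
    (no_source : source_free arc)
    (has_kernel : exists K : {set V}, is_kernel arc K) :
  exists Q : {set V}, is_quasi_kernel arc Q /\ 2 * #|Q| <= #|V|.
Proof.
have [K [indK domK]] := has_kernel.
(* The default [v] is returned only for [v] in [K], while [f] is applied only on [~: K]. *)
pose f v := odflt v [pick u in K | arc u v].
have fP v : v \notin K -> (f v \in K) && arc (f v) v.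
  move=> vNK; rewrite /f; case: pickP => [u // | noarc].
  by have [u uK uv] := domK v vNK; have := noarc u; rewrite uK uv.
have QK : f @: (~: K) \subset K.
  by apply/subsetP=> u /imsetP[v]; rewrite inE => /fP/andP[fK _] ->.
exists (f @: (~: K)); split; last first.
  (* One copy of [#|Q|] is bounded by [#|K|] through inclusion, the other by [#|~: K|] as the size
     of an image. *)
  by rewrite mul2n -addnn -(cardsC K) leq_add ?leq_imset_card ?subset_leq_card.
have domQ v : v \notin K -> exists2 u, u \in f @: (~: K) & arc u v.
  move=> vNK; have /andP[_ fv] := fP v vNK.
  by exists (f v); rewrite ?imset_f ?inE.
split=> [u v uQ vQ | v]; first by apply: indK; apply: (subsetP QK).
have [vK | vNK] := boolP (v \in K); last by constructor 2; exact: domQ.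
have [w wv] := no_source v.
have wNK : w \notin K by apply: contraL wv => wK; exact: indK.
have [u uQ uw] := domQ w wNK.
(* Here [u = v] may occur, when [v] is itself a chosen vertex; the definition allows such a closed
   walk. *)
by constructor 3; exists u => //; exists w.
Qed.
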